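(* Let $(K,\partial)\subseteq(L,\partial)$ be an extension of fields (of characteristic $p>0$) with operators linear over the constants. Then $L^\partial$ and $K$ are linearly disjoint over $K^\partial$.
   Context: Let $p$ be a prime. A field with operators linear over the constants is a field $K$ of characteristic $p$ with a (possibly infinite) tuple of unary functions $\partial=(\partial_i\colon K\to K)_{i\in I}$ such that: each $\partial_i$ is additive; the set of constants $K^\partial=\{x\in K:\partial_i(x)=0\text{ for all }i\in I\}$ is a field; and $\partial_i(ax)=a\,\partial_i(x)$ for all $i\in I$, $a\in K^\partial$, $x\in K$. An extension $(K,\partial)\subseteq(L,\partial)$ is a field extension $K\subseteq L$ where both $K$ and $L$ are fields with operators in this sense, indexed by the same set $I$, and the operators of $L$ restrict to those of $K$. *)

(* Defs.v *)
From HB Require Import structures.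
From mathcomp Require Import all_boot all_order all_algebra.
From mathcomp Require Import boolp classical_sets.

Set Implicit Arguments.
Unset Strict Implicit.
Unset Printing Implicit Defensive.

Import GRing.Theory.
Local Open Scope ring_scope.
Local Open Scope classical_set_scope.

Section FieldsWithOperators.

Variable I : Type.

Definition constants (K : fieldType) (d : I -> K -> K) : set K :=
  [set x | forall i, d i x = 0].

(* [p \in [pchar K]] also asserts that [p] is prime. *)
Record linear_over_constants (p : nat) (K : fieldType) (d : I -> K -> K) :
    Prop := LinearOverConstants {
  opf_pchar : p \in [pchar K];
  opf_additive : forall i, {morph d i : x y / x + y};
  opf_constants_field : GRing.divring_closed (mem (constants d));
  opf_linear : forall i a x, constants d a -> d i (a * x) = a * d i x
}.

(* The inclusion of [K] in [L] is represented by the field morphism [iota]. *)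
Record operator_extension (p : nat) (K L : fieldType)
    (dK : I -> K -> K) (dL : I -> L -> L) (iota : {rmorphism K -> L}) :
    Prop := OperatorExtension {
  opx_base : linear_over_constants p dK;
  opx_top : linear_over_constants p dL;
  opx_restrict : forall i x, dL i (iota x) = iota (dK i x)
}.

End FieldsWithOperators.

Section LinearDisjointness.

Variable M : fieldType.

Definition independent_over (k : set M) (n : nat) (v : 'I_n -> M) : Prop :=
  forall c : 'I_n -> M, (forall j, k (c j)) ->
    \sum_(j < n) c j * v j = 0 -> forall j, c j = 0.

(* Lang's definition; for subfields [E] and [F] of [M] containing the subfield
   [k] it is symmetric in [E] and [F], and equivalent to injectivity of the
   multiplication map from the tensor product of [E] and [F] over [k] to [M]. *)
Definition linearly_disjoint (E F k : set M) : Prop :=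
  forall (n : nat) (v : 'I_n -> M), (forall j, E (v j)) ->
    independent_over k v -> independent_over F v.

End LinearDisjointness.

(* Main.v *)
Require Import Defs.
From HB Require Import structures.
From mathcomp Require Import all_boot all_order all_algebra.
From mathcomp Require Import boolp classical_sets.

Local Open Scope ring_scope.
Local Open Scope classical_set_scope.

(** The argument is the one for Wronskians: a shortest nontrivial linear
    relation [\sum_j c_j v_j = 0], with [c_j] in [K] and constants [v_j] of [L],
    may be scaled so that one coefficient is [1]. The operators pass through the
    [v_j] and act on the coefficients alone ([operator_relation]), and they kill
    the coefficient [1], because [1] lies in the field of constants. Each
    operator thus yields a strictly shorter relation, which must be trivial; so
    all the scaled coefficients are constants of [K], and the relation
    contradicts the independence of the [v_j] over them. The descent is
    [constants_no_relation]. *)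

Import GRing.Theory.

Lemma operator0 {p : nat} {I : Type} {K : fieldType} {d : I -> K -> K} :
  linear_over_constants p d -> forall i, d i 0 = 0.
Proof.
by move=> dP i; apply: (addrI (d i 0)); rewrite -(opf_additive dP) !addr0.
Qed.

Lemma operator1 {p : nat} {I : Type} {K : fieldType} {d : I -> K -> K} :
  linear_over_constants p d -> forall i, d i 1 = 0.
Proof. by move=> dP; case: (opf_constants_field dP) => /set_mem. Qed.

Lemma operator_relation {p : nat} {I : Type} {K L : fieldType}
    {dK : I -> K -> K} {dL : I -> L -> L} {iota : {rmorphism K -> L}}
    {n : nat} (v : 'I_n -> L) (c : 'I_n -> K) (i : I) :
  operator_extension p dK dL iota -> (forall j, constants dL (v j)) ->
  \sum_(j < n) iota (c j) * v j = 0 ->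
  \sum_(j < n) iota (dK i (c j)) * v j = 0.
Proof.
move=> ext v_const rel; have top := opx_top ext.
transitivity (dL i (\sum_(j < n) iota (c j) * v j)); last first.
  by rewrite rel (operator0 top).
rewrite (big_morph _ (opf_additive top i) (operator0 top i)).
apply: eq_bigr => j _.
by rewrite [iota (c j) * _]mulrC (opf_linear top) // (opx_restrict ext) mulrC.
Qed.

(** Taking the coefficients in [K] rather than in its image lets the operators
    of [K] act on them; the induction is on the number of nonzero ones. *)
Lemma constants_no_relation {p : nat} {I : Type} {K L : fieldType}
    {dK : I -> K -> K} {dL : I -> L -> L} {iota : {rmorphism K -> L}}
    {n : nat} (v : 'I_n -> L) :
  operator_extension p dK dL iota -> (forall j, constants dL (v j)) ->
  independent_over (iota @` constants dK) v ->
  forall c : 'I_n -> K,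
    \sum_(j < n) iota (c j) * v j = 0 -> forall j, c j = 0.
Proof.
move=> ext v_const v_indep c; have base := opx_base ext.
have [m] := ubnP #|[pred j | c j != 0]|.
elim: m c => // m IHm c; rewrite ltnS => supp_le_m rel j0.
apply/eqP/negPn/negP => cj0_neq0.
pose b j := (c j0)^-1 * c j.
have b_j0 : b j0 = 1 by rewrite /b mulVf.
have b_rel : \sum_(j < n) iota (b j) * v j = 0.
  under eq_bigr => j _ do rewrite rmorphM -mulrA.
  by rewrite -mulr_sumr rel mulr0.
have b_const j : constants dK (b j).
  move=> i; apply: (IHm (fun j => dK i (b j))); last first.
    exact: (operator_relation v b i ext v_const b_rel).
  apply: leq_trans supp_le_m; apply: proper_card; apply/properP.
  (* No zero coefficient becomes nonzero, and the one at j0 is killed. *)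
  split; last by exists j0; rewrite !inE ?b_j0 ?(operator1 base) ?eqxx.
  apply/fintype.subsetP => k; rewrite !inE; apply: contraNneq => ck0.
  by rewrite /b ck0 mulr0 (operator0 base).
have /eqP := v_indep (iota \o b) (fun j => ex_intro2 _ _ _ (b_const j) erefl)
  b_rel j0.
by rewrite /= b_j0 rmorph1 oner_eq0.
Qed.

Theorem lemma2p2 (p : nat) (I : Type) (K L : fieldType)
    (dK : I -> K -> K) (dL : I -> L -> L) (iota : {rmorphism K -> L}) :
  operator_extension p dK dL iota ->
  linearly_disjoint (constants dL) (range iota) (iota @` constants dK).
Proof.
move=> ext n v v_const v_indep c c_range rel j.
have /boolp.choice[b b_c] k : exists x, iota x = c k.
  by case: (c_range k) => x _ <-; exists x.
rewrite -b_c (constants_no_relation v ext v_const v_indep b) ?rmorph0 //.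
by under eq_bigr => k _ do rewrite b_c.
Qed.
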